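(* For $i=1,2$ let $\Sigma_i=(S_i,\sigma_i,\mu_i)$ be a signed graph of order $n_i$ with marking $\mu_i$, and let $\Sigma_{i\mu}$ be its $\mu$-signed graph. Let $\lambda'_{11},\dots,\lambda'_{1n_1}$ be the eigenvalues of $A(\Sigma_{1\mu})$. Write the signed adjacency coronal of $\Sigma_{2\mu}$ in reduced form $\chi_{A(\Sigma_{2\mu})}(x)=P'_{d-1}(x)/F'_d(x)$, and let $R'_{n_2-d}(x)$ be the corresponding greatest common divisor, so that $\det(xI_{n_2}-A(\Sigma_{2\mu}))=R'_{n_2-d}(x)F'_d(x)$. Then the characteristic polynomial of the adjacency matrix of the product $\Sigma_1\circledast\Sigma_2$ is $$f(A(\Sigma_1\circledast\Sigma_2),x)=x^{n_1(n_2-1)}\,R'_{n_2-d}(x)^{n_1}\prod_{i=1}^{n_1}\Big[xF'_d(x)-n_2\big(\lambda'_{1i}F'_d(x)+P'_{d-1}(x)\big)\Big].$$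
   Context: A signed graph is a triple $\Sigma=(S,\sigma,\mu)$ where $S=(V,E)$ is a finite simple undirected graph, $\sigma:E\to\{+1,-1\}$ is a signature and $\mu:V\to\{+1,-1\}$ is a marking. Its adjacency matrix $A(\Sigma)$ has $(i,j)$ entry $\sigma(u_iu_j)$ if $u_i\sim u_j$ and $0$ otherwise. The $\mu$-signed graph of $\Sigma$ is $\Sigma_\mu=(S,\sigma_\mu,\mu)$ with $\sigma_\mu(uv)=\mu(u)\mu(v)$ for every edge $uv$. Write $\mu(\Sigma)\in\{\pm1\}^n$ for the column vector of vertex marks. The signed adjacency coronal of $\Sigma_\mu$ (order $n$) is the rational function $\chi_{A(\Sigma_\mu)}(x)=\mu(\Sigma)^T(xI_n-A(\Sigma_\mu))^{-1}\mu(\Sigma)$. Writing it as $p(x)/f(x)$ with $f(x)=\det(xI_n-A(\Sigma_\mu))$ and $p(x)=\mu(\Sigma)^T\mathrm{adj}(xI_n-A(\Sigma_\mu))\mu(\Sigma)$, let $R'_{n-d}(x)$ be the monic greatest common divisor of $p$ and $f$ (of degree $n-d$), $F'_d=f/R'_{n-d}$ (degree $d$) and $P'_{d-1}=p/R'_{n-d}$ (degree $d-1$). Product $\Sigma_1\circledast\Sigma_2$: if $\Sigma_1$ has vertices $u_1,\dots,u_{n_1}$ and $\Sigma_2$ has vertices $v_1,\dots,v_{n_2}$, then $\Sigma_1\circledast\Sigma_2$ has the $2n_1n_2$ vertices $a_{ij},b_{ij}$ ($1\le i\le n_1$, $1\le j\le n_2$) with marking $\mu(a_{ij})=\mu_1(u_i)$,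 $\mu(b_{ij})=\mu_2(v_j)$. Its edges are: $a_{ik}a_{jl}$ for all $1\le k,l\le n_2$ whenever $u_iu_j\in E(\Sigma_1)$; $b_{ri}b_{rj}$ for all $1\le r\le n_1$ whenever $v_iv_j\in E(\Sigma_2)$; and $a_{ip}b_{iq}$ for all $1\le i\le n_1$, $1\le p,q\le n_2$. Every edge $xy$ of the product gets sign $\mu(x)\mu(y)$. *)

(* Defs.v *)
From HB Require Import structures.
From mathcomp Require Import all_boot all_order all_algebra fraction.
Set Implicit Arguments.
Unset Strict Implicit.
Unset Printing Implicit Defensive.
Import Order.TTheory GRing.Theory Num.Theory.
Local Open Scope ring_scope.

Notation "x %:F" := (@FracField.tofrac _ x) : ring_scope.

Record simple_graph (V : finType) := SimpleGraph {
  adj : rel V;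
  adj_sym : symmetric adj;
  adj_irr : irreflexive adj
}.

Definition is_sign (z : int) : Prop := z = 1 \/ z = -1.

Lemma is_signM (y z : int) : is_sign y -> is_sign z -> is_sign (y * z).
Proof.
by case=> ->; case=> ->; rewrite ?mul1r ?mulr1 ?mulrNN ?mulr1; [left|right|right|left].
Qed.

(* The signature is a function on edges: only the values [sigma u v] with
   [adj graph u v] are meaningful. *)
Record signed_graph (V : finType) := SignedGraph {
  graph :> simple_graph V;
  sigma : V -> V -> int;
  mark : V -> int;
  sigma_sym : forall u v, adj graph u v -> sigma u v = sigma v u;
  sigma_sign : forall u v, adj graph u v -> is_sign (sigma u v);
  mark_sign : forall u, is_sign (mark u)
}.

Section MarkSigned.
Variables (V : finType) (G : simple_graph V) (mu : V -> int).
Hypothesis mu_sign : forall u, is_sign (mu u).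

Lemma mark_sigma_sym u v : adj G u v -> mu u * mu v = mu v * mu u.
Proof. by rewrite mulrC. Qed.

Lemma mark_sigma_sign u v : adj G u v -> is_sign (mu u * mu v).
Proof. by move=> _; apply: is_signM. Qed.

Definition marked_graph : signed_graph V :=
  @SignedGraph V G (fun u v => mu u * mu v) mu
    mark_sigma_sym mark_sigma_sign mu_sign.
End MarkSigned.

Definition mu_signed (V : finType) (S : signed_graph V) : signed_graph V :=
  marked_graph (graph S) (@mark_sign V S).

Section Product.
Variables (V1 V2 : finType) (S1 : signed_graph V1) (S2 : signed_graph V2).

(* [inl (u_i, v_j)] is the vertex a_ij and [inr (u_i, v_j)] the vertex b_ij. *)
Definition prod_vertex : finType := ((V1 * V2) + (V1 * V2))%type.

Definition prod_adj (x y : prod_vertex) : bool :=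
  match x, y with
  | inl (i, _), inl (j, _) => adj S1 i j
  | inr (r, i), inr (s, j) => (r == s) && adj S2 i j
  | inl (i, _), inr (j, _) => i == j
  | inr (i, _), inl (j, _) => i == j
  end.

Lemma prod_adj_sym : symmetric prod_adj.
Proof.
move=> [[i k]|[i k]] [[j l]|[j l]] /=.
- exact: adj_sym.
- exact: eq_sym.
- exact: eq_sym.
- by rewrite eq_sym adj_sym.
Qed.

Lemma prod_adj_irr : irreflexive prod_adj.
Proof.
by move=> [[i k]|[i k]] /=; rewrite ?(adj_irr S1) ?(adj_irr S2) ?andbF.
Qed.

Definition prod_graph : simple_graph prod_vertex :=
  SimpleGraph prod_adj_sym prod_adj_irr.

Definition prod_mark (x : prod_vertex) : int :=
  match x with
  | inl (i, _) => mark S1 i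
  | inr (_, j) => mark S2 j
  end.

Lemma prod_mark_sign x : is_sign (prod_mark x).
Proof. by case: x => [[i j]|[i j]]; apply: mark_sign. Qed.

Definition sgprod : signed_graph prod_vertex :=
  marked_graph prod_graph prod_mark_sign.
End Product.

Section Coronal.
Variables (R : rcfType) (V : finType) (S : signed_graph V).

(* The ordering u_1, ..., u_n of the vertices is the enumeration of [V]. *)
Definition adjmx : 'M[R]_#|V| :=
  \matrix_(i, j) if adj S (enum_val i) (enum_val j)
                 then (sigma S (enum_val i) (enum_val j))%:~R else 0.

Definition markv : 'cV[R]_#|V| := \col_i (mark S (enum_val i))%:~R.

Definition coronal : {fraction {poly R}} :=
  let mu := map_mx (fun a : R => a%:P%:F) markv in
  (mu^T *m invmx (('X%:F)%:M - map_mx (fun a : R => a%:P%:F) adjmx) *m mu) 0 0.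

Definition coronal_num : {poly R} :=
  ((map_mx polyC markv)^T *m \adj (char_poly_mx adjmx) *m map_mx polyC markv) 0 0.

Definition coronal_den : {poly R} := char_poly adjmx.

Definition monic_gcd (p q : {poly R}) : {poly R} :=
  (lead_coef (gcdp p q))^-1 *: gcdp p q.

(* P is P'_{d-1}, F is F'_d and G is R'_{n-d}.  The degrees of P and G
   are consequences. *)
Definition coronal_reduced_form (d : nat) (P F G : {poly R}) : Prop :=
  [/\ coronal = P%:F / F%:F,
      coprimep P F,
      size F = d.+1,
      G = monic_gcd coronal_num coronal_den &
      coronal_den = G * F].

Lemma char_poly_mx_frac :
  ('X%:F)%:M - map_mx (fun a : R => a%:P%:F) adjmx
  = map_mx (@FracField.tofrac {poly R}) (char_poly_mx adjmx).
Proof.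
apply/matrixP=> i j; rewrite !mxE tofracB; congr (_ - _).
by case: (_ == _); rewrite ?mulr1n ?mulr0n ?tofrac0.
Qed.

Lemma coronal_den_neq0 : coronal_den != 0.
Proof. exact/monic_neq0/char_poly_monic. Qed.

Lemma coronalE : coronal = coronal_num%:F / coronal_den%:F.
Proof.
rewrite /coronal char_poly_mx_frac /coronal_num /coronal_den /char_poly.
set M := char_poly_mx _; set t := @FracField.tofrac {poly R}.
have dM : \det (map_mx t M) = (\det M)%:F by rewrite det_map_mx.
have uM : map_mx t M \in unitmx.
  by rewrite unitmxE dM unitfE tofrac_eq0 coronal_den_neq0.
have -> : map_mx (fun a : R => a%:P%:F) markv = map_mx t (map_mx polyC markv).
  by apply/matrixP=> i j; rewrite !mxE.
rewrite /invmx uM dM !map_trmx -map_mx_adj -scalemxAr -scalemxAl -!(map_mxM (@FracField.tofrac {poly R})).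
by rewrite mxE [X in _ * X]mxE mulrC.
Qed.

Lemma coronal_reduced_form_exists :
  exists d P F G, coronal_reduced_form d P F G.
Proof.
pose G := monic_gcd coronal_num coronal_den.
have g0 : gcdp coronal_num coronal_den != 0.
  by rewrite gcdp_eq0 (negbTE coronal_den_neq0) andbF.
have l0 : (lead_coef (gcdp coronal_num coronal_den))^-1 != 0.
  by rewrite invr_eq0 lead_coef_eq0.
have Gg : G %= gcdp coronal_num coronal_den by apply: eqp_scale.
have G0 : G != 0 by rewrite scaler_eq0 negb_or l0.
have nG : coronal_num = coronal_num %/ G * G.
  by rewrite divpK // (eqp_dvdl _ Gg) dvdp_gcdl.
have dG : coronal_den = G * (coronal_den %/ G).
  by rewrite mulrC divpK // (eqp_dvdl _ Gg) dvdp_gcdr.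
have F0 : coronal_den %/ G != 0.
  by apply: contraNneq coronal_den_neq0 => e; rewrite dG e mulr0.
exists (size (coronal_den %/ G)).-1, (coronal_num %/ G), (coronal_den %/ G), G.
split=> //.
- rewrite coronalE; apply/eqP.
  rewrite eqr_div ?tofrac_eq0 ?coronal_den_neq0 // -!tofracM tofrac_eq.
  by rewrite {1}nG -mulrA -dG.
- have l0' := l0; rewrite -invr_eq0 in l0'.
  rewrite /G /monic_gcd (divpZr _ _ l0) (divpZr coronal_den _ l0).
  rewrite (coprimepZl _ _ l0') (coprimepZr _ _ l0').
  by rewrite coprimep_div_gcd // coronal_den_neq0 orbT.
- by rewrite prednK // lt0n size_poly_eq0.
Qed.
End Coronal.

(* [lam] lists the eigenvalues of [A] with algebraic multiplicity. *)
Definition eigenvalues (R : rcfType) n (A : 'M[R]_n) (lam : 'I_n -> R) : Prop :=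
  char_poly A = \prod_(i < n) ('X - (lam i)%:P).

(* Main.v *)
(** Kronecker products give the adjacency matrix of the product the block form
    [[A1 (x) J, D1 (x) 1 m2^T], [D1 (x) m2 1^T, I (x) A2]], where J = 1 1^T has
    order n2, m2 is the vector of marks of the second graph and D1 is the
    diagonal matrix of marks of the first.  Over the fractions of R[x],
    I (x) (x - A2) is invertible; as D1^2 = I, the Schur complement of this
    block in x - A is x - (A1 + chi I) (x) J, with chi the coronal of the second
    graph.  Since J = 1 1^T and 1^T 1 = n2, Sylvester's identity turns its
    determinant into x^(n1 (n2 - 1)) det (x - n2 (A1 + chi I)), the product of
    the factors x - n2 (lambda_i + chi).  The determinant of I (x) (x - A2) is
    (R' F')^n1, which clears the denominators of chi = P' / F'. *)
Require Import Defs.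
From mathcomp Require Import all_boot all_algebra fraction perm mxtens ring.
Set Implicit Arguments.
Unset Strict Implicit.
Unset Printing Implicit Defensive.
Import GRing.Theory.
Local Open Scope ring_scope.

Section Determinants.
Variable K : comNzRingType.

Lemma det_block_mx_schur m n (A : 'M[K]_m) (B : 'M_(m, n)) (C : 'M_(n, m))
    (D D' : 'M_n) :
  D *m D' = 1%:M ->
  \det (block_mx A B C D) = \det D * \det (A - B *m D' *m C).
Proof.
move=> DD'.
have -> : block_mx A B C D = block_mx (A - B *m D' *m C) B 0 D
                             *m block_mx 1%:M 0 (D' *m C) 1%:M.
  rewrite mulmx_block !mulmx1 !mulmx0 ?mul0mx !add0r.
  by rewrite [D *m (_ *m _)]mulmxA DD' mul1mx [B *m (_ *m _)]mulmxA subrK.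
by rewrite det_mulmx det_ublock det_lblock !det1 !mulr1 mulrC.
Qed.

(* Sylvester's identity: both sides are x^n times the determinant of the block
   matrix [[x, U], [W, 1]]. *)
Lemma det_scalar_sub_mulC m n (x : K) (U : 'M_(m, n)) (W : 'M_(n, m)) :
  x ^+ n * \det (x%:M - U *m W) = x ^+ m * \det (x%:M - W *m U).
Proof.
have := det_block_mx_schur x%:M U W (mulmx1 1%:M).
rewrite det1 mul1r mulmx1 => <-.
have <- : \det (block_mx 1%:M (- U) 0 x%:M) = x ^+ n.
  by rewrite det_ublock det1 mul1r det_scalar.
rewrite mulrC -det_mulmx mulmx_block !mulmx1 !mulmx0 mul1mx !addr0.
rewrite mul_scalar_mx mul_mx_scalar scalerN addNr mulmxN addrC.
by rewrite det_lblock det_scalar addrC.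
Qed.

Lemma det_castmx m n (eq_mn eq_mn' : m = n) (A : 'M[K]_m) :
  \det (castmx (eq_mn, eq_mn') A) = \det A.
Proof. by case: n / eq_mn eq_mn' => eq_mm; rewrite castmx_id. Qed.

Lemma det_mxsub_bij m n (f : 'I_n -> 'I_m) (A : 'M[K]_m) :
  bijective f -> \det (mxsub f f A) = \det A.
Proof.
move=> f_bij; have /esym eq_mn : n = m.
  by rewrite -(card_ord n) (bij_eq_card f_bij) card_ord.
case: n / eq_mn f f_bij => f f_bij.
pose s := perm (bij_inj f_bij).
have -> : mxsub f f A = row_perm s (col_perm s A).
  by apply/matrixP=> i j; rewrite !mxE !permE.
rewrite row_permE col_permE !det_mulmx !det_perm odd_permV.
by rewrite mulrCA -expr2 sqrr_sign mulr1.
Qed.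

Lemma horner_char_poly n (A : 'M[K]_n) x :
  (char_poly A).[x] = \det (x%:M - A).
Proof.
rewrite -horner_evalE -det_map_mx; congr (\det _).
by apply/matrixP=> i j; rewrite !mxE /= horner_evalE !hornerE hornerMn hornerX.
Qed.

End Determinants.

Lemma char_poly_mxsub_bij (K : comNzRingType) m n (f : 'I_n -> 'I_m)
    (A : 'M[K]_m) :
  bijective f -> char_poly (mxsub f f A) = char_poly A.
Proof.
move=> f_bij; rewrite /char_poly -(det_mxsub_bij (char_poly_mx A) f_bij).
congr (\det _); apply/matrixP=> i j.
by rewrite !mxE (inj_eq (bij_inj f_bij)).
Qed.

Lemma det_scalar_subZ (K : fieldType) n (A : 'M[K]_n) (lam : 'I_n -> K) x c :
  char_poly A = \prod_(i < n) ('X - (lam i)%:P) ->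
  \det (x%:M - c *: A) = \prod_(i < n) (x - c * lam i).
Proof.
move=> char_polyA; have [->|c_neq0] := eqVneq c 0.
  rewrite scale0r subr0 det_scalar -[in LHS](card_ord n) -prodr_const.
  by apply: eq_bigr => i _; rewrite mul0r subr0.
have -> : x%:M - c *: A = c *: ((c^-1 * x)%:M - A).
  by rewrite scalerBr scale_scalar_mx mulVKf.
rewrite detZ -horner_char_poly char_polyA horner_prod.
rewrite -[n in c ^+ n]card_ord -prodr_const -big_split /=.
by apply: eq_bigr => i _; rewrite !hornerE mulrBr mulVKf.
Qed.

Lemma dot_ones (K : pzRingType) n (ones : 'cV[K]_n := const_mx 1) :
  (ones^T *m ones) 0 0 = n%:R.
Proof.
rewrite mxE; under eq_bigr do rewrite !mxE mulr1.
by rewrite sumr_const card_ord.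
Qed.

Section KroneckerProduct.
Variable K : comNzRingType.

Lemma tensmxDl m n p q (A B : 'M[K]_(m, n)) (C : 'M_(p, q)) :
  (A + B) *t C = A *t C + B *t C.
Proof. by apply/matrixP=> i j; rewrite !mxE mulrDl. Qed.

Lemma tensmxBl m n p q (A B : 'M[K]_(m, n)) (C : 'M_(p, q)) :
  (A - B) *t C = A *t C - B *t C.
Proof. by apply/matrixP=> i j; rewrite !mxE mulrBl. Qed.

Lemma tensmxBr m n p q (A : 'M[K]_(m, n)) (B C : 'M_(p, q)) :
  A *t (B - C) = A *t B - A *t C.
Proof. by apply/matrixP=> i j; rewrite !mxE mulrBr. Qed.

Lemma tensmx_scalar m n p (c : K) (A : 'M_(m, n)) :
  A *t (c%:M : 'M_p) = (c *: A) *t 1%:M.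
Proof. by apply/matrixP=> i j; rewrite !mxE mulr_natr mulrnAr mulrC. Qed.

Lemma tens_scalar_scalar m n (a b : K) :
  (a%:M : 'M_m) *t (b%:M : 'M_n) = (a * b)%:M.
Proof.
apply/matrixP=> i j.
case: (mxtens_indexP i) => i1 i2; case: (mxtens_indexP j) => j1 j2.
rewrite tensmxE !mxE mulrnAl mulrnAr -mulrnA mulnb andbC.
by rewrite (can_eq (@mxtens_indexK _ _)).
Qed.

Lemma det_tens1mx m n (A : 'M[K]_n) : \det ((1%:M : 'M_m) *t A) = \det A ^+ m.
Proof.
elim: m => [|m IHm]; first by rewrite det_mx00.
rewrite (scalar_mx_block 1 m) tens_block_mx det_castmx tens0mx det_lblock.
by rewrite tens_scalar1mx det_castmx IHm exprS.
Qed.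

Lemma det_tensmx1 m n (A : 'M[K]_m) : \det (A *t (1%:M : 'M_n)) = \det A ^+ n.
Proof.
pose swap p q (k : 'I_(p * q)) : 'I_(q * p) :=
  let: (i, j) := mxtens_unindex k in mxtens_index (j, i).
have swapK p q : cancel (@swap p q) (@swap q p).
  by move=> k; case: (mxtens_indexP k) => i j; rewrite /swap !mxtens_indexK.
rewrite -det_tens1mx -(det_mxsub_bij _ (Bijective (swapK m n) (swapK n m))).
congr (\det _); apply/matrixP=> k l; rewrite [RHS]mxE.
case: (mxtens_indexP k) (mxtens_indexP l) => i j [i' j'].
by rewrite /swap !mxtens_indexK !tensmxE mulrC.
Qed.

(* The factor x^m on the left avoids the exponent n - 1, truncated at n = 0. *)
Lemma det_scalar_sub_tens_rank1 m n (x : K) (A : 'M_m) (u : 'cV_n)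
    (w : 'rV_n) :
  x ^+ m * \det (x%:M - A *t (u *m w)) =
  x ^+ (m * n) * \det (x%:M - (w *m u) 0 0 *: A).
Proof.
have -> : A *t (u *m w) = (A *t u) *m (1%:M *t w).
  by rewrite tensmx_mul mulmx1.
rewrite -[in x ^+ m](muln1 m) det_scalar_sub_mulC tensmx_mul mul1mx.
rewrite [in LHS](mx11_scalar (w *m u)) tensmx_scalar -[x in x%:M]mulr1.
by rewrite -tens_scalar_scalar -tensmxBl det_tensmx1 expr1.
Qed.

End KroneckerProduct.

(* With [u] the all-ones vector, [A1] and [A2] the adjacency matrices of two
   mu-signed graphs, [D] the diagonal matrix of marks of the first and [v] the
   vector of marks of the second, this is the adjacency matrix of the product. *)
Definition sgprod_mx (K : pzRingType) m n (A1 D : 'M[K]_m) (A2 : 'M_n)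
    (u v : 'cV_n) : 'M_(m * n + m * n) :=
  block_mx (A1 *t (u *m u^T)) (D *t (u *m v^T))
           (D *t (v *m u^T)) (1%:M *t A2).

Lemma map_sgprod_mx (K L : pzRingType) (f : {rmorphism K -> L}) m n
    (A1 D : 'M_m) (A2 : 'M_n) (u v : 'cV_n) :
  map_mx f (sgprod_mx A1 D A2 u v) =
  sgprod_mx (map_mx f A1) (map_mx f D) (map_mx f A2) (map_mx f u) (map_mx f v).
Proof.
by rewrite /sgprod_mx map_block_mx !map_mxT !map_mxM !map_trmx map_mx1.
Qed.

Lemma det_scalar_sub_sgprod_mx (K : comUnitRingType) m n (A1 D : 'M[K]_m)
    (A2 : 'M_n) (u v : 'cV_n) (x : K)
    (chi := (v^T *m invmx (x%:M - A2) *m v) 0 0) :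
  D *m D = 1%:M -> x%:M - A2 \in unitmx ->
  x ^+ m * \det (x%:M - sgprod_mx A1 D A2 u v) =
  x ^+ (m * n) * \det (x%:M - A2) ^+ m *
  \det (x%:M - (u^T *m u) 0 0 *: (A1 + chi%:M)).
Proof.
move=> D_sq xA2_unit.
have inv_dr : (1%:M *t (x%:M - A2)) *m (1%:M *t invmx (x%:M - A2)) = 1%:M
    :> 'M_(m * n).
  by rewrite tensmx_mul mul1mx mulmxV // tens_scalar_scalar mulr1.
have schur_complement :
    x%:M - A1 *t (u *m u^T)
    - - (D *t (u *m v^T)) *m (1%:M *t invmx (x%:M - A2))
      *m - (D *t (v *m u^T))
    = x%:M - (A1 + chi%:M) *t (u *m u^T).
  rewrite mulmxN !mulNmx opprK !tensmx_mul mulmx1 D_sq.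
  have -> : u *m v^T *m invmx (x%:M - A2) *m (v *m u^T)
            = u *m chi%:M *m u^T.
    by rewrite -mx11_scalar !mulmxA.
  rewrite mul_mx_scalar -scalemxAl tensmxDl opprD addrA; congr (_ - _).
  by apply/matrixP=> i j; rewrite !mxE mulrnAl mul1r mulrnAl.
have -> : x%:M - sgprod_mx A1 D A2 u v =
    block_mx (x%:M - A1 *t (u *m u^T)) (- (D *t (u *m v^T)))
             (- (D *t (v *m u^T))) (1%:M *t (x%:M - A2)).
  rewrite /sgprod_mx scalar_mx_block opp_block_mx add_block_mx !add0r.
  by rewrite tensmxBr tens_scalar_scalar mul1r.
rewrite (det_block_mx_schur _ _ _ inv_dr) schur_complement det_tens1mx.
by rewrite mulrCA det_scalar_sub_tens_rank1 mulrCA mulrA.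
Qed.

Lemma det_scalar_sub_sgprod_mx_eigenvalues (K : fieldType) m n
    (A1 D : 'M[K]_m) (A2 : 'M_n) (u v : 'cV_n) (x p f g : K) (lam : 'I_m -> K) :
  D *m D = 1%:M -> char_poly A1 = \prod_(i < m) ('X - (lam i)%:P) ->
  x%:M - A2 \in unitmx -> \det (x%:M - A2) = g * f ->
  (v^T *m invmx (x%:M - A2) *m v) 0 0 = p / f ->
  x ^+ m * \det (x%:M - sgprod_mx A1 D A2 u v) =
  x ^+ (m * n) * g ^+ m *
  \prod_(i < m) (x * f - (u^T *m u) 0 0 * (lam i * f + p)).
Proof.
move=> D_sq char_polyA1 xA2_unit det_xA2 chiE.
have f_neq0 : f != 0.
  have : g * f != 0 by rewrite -det_xA2 -unitfE -unitmxE.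
  by rewrite mulf_eq0 => /norP[].
rewrite det_scalar_sub_sgprod_mx // chiE det_xA2.
set c := (u^T *m u) 0 0.
have -> : x%:M - c *: (A1 + (p / f)%:M) = (x - c * (p / f))%:M - c *: A1.
  by rewrite scalerDr opprD addrCA addrC scale_scalar_mx raddfB.
rewrite (det_scalar_subZ _ _ char_polyA1) exprMn mulrA -mulrA.
rewrite -[in f ^+ m](card_ord m) -prodr_const -big_split /=.
by congr (_ * _); apply: eq_bigr => i _; field.
Qed.

Section RationalFunctions.
Variable R : idomainType.
Implicit Types (P F G : {poly R}).

Local Notation const := (@FracField.tofrac {poly R} \o polyC).

Lemma tofrac_char_poly n (A : 'M[R]_n) :
  (char_poly A)%:F = \det ('X%:F%:M - map_mx const A).
Proof.
rewrite -det_map_mx; congr (\det _); apply/matrixP=> i j.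
by rewrite !mxE /= tofracB tofracMn.
Qed.

Definition coronal_mx n (A : 'M[R]_n) (v : 'cV_n) : {fraction {poly R}} :=
  ((map_mx const v)^T *m invmx ('X%:F%:M - map_mx const A)
   *m map_mx const v) 0 0.

Lemma char_poly_sgprod_mx m n (A1 D : 'M[R]_m) (A2 : 'M_n) (u v : 'cV_n)
    (lam : 'I_m -> R) P F G (c := (u^T *m u) 0 0) :
  D *m D = 1%:M ->
  char_poly A1 = \prod_(i < m) ('X - (lam i)%:P) ->
  coronal_mx A2 v = P%:F / F%:F -> char_poly A2 = G * F ->
  'X^m * char_poly (sgprod_mx A1 D A2 u v) =
  'X^(m * n) * G ^+ m *
  \prod_(i < m) ('X * F - c%:P * ((lam i)%:P * F + P)).
Proof.
move=> D_sq char_polyA1 coronalA2 char_polyA2.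
have char_polyA1_frac :
    char_poly (map_mx const A1) = \prod_(i < m) ('X - (const (lam i))%:P).
  rewrite -map_char_poly char_polyA1 rmorph_prod.
  by apply: eq_bigr => i _; rewrite rmorphB /= map_polyX map_polyC.
have D_frac_sq : map_mx const D *m map_mx const D = 1%:M.
  by rewrite -map_mxM D_sq map_mx1.
have XA2_unit : 'X%:F%:M - map_mx const A2 \in unitmx.
  rewrite unitmxE -tofrac_char_poly unitfE tofrac_eq0.
  exact/monic_neq0/char_poly_monic.
have det_XA2 : \det ('X%:F%:M - map_mx const A2) = G%:F * F%:F.
  by rewrite -tofrac_char_poly char_polyA2 tofracM.
apply/eqP; rewrite -tofrac_eq; apply/eqP.
rewrite tofracM tofrac_char_poly tofracXn map_sgprod_mx.
rewrite (det_scalar_sub_sgprod_mx_eigenvalues _ D_frac_sq char_polyA1_frac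
  XA2_unit det_XA2 coronalA2).
rewrite map_trmx -map_mxM mxE -/c !tofracM !tofracXn rmorph_prod.
congr (_ * _); apply: eq_bigr => i _.
by rewrite /= tofracB !tofracM tofracD tofracM.
Qed.

End RationalFunctions.

Section ProductVertices.
Variables V1 V2 : finType.

Definition pair_of_ord (k : 'I_(#|V1| * #|V2|)) : V1 * V2 :=
  (enum_val (mxtens_unindex k).1, enum_val (mxtens_unindex k).2).

Definition ord_of_pair (p : V1 * V2) : 'I_(#|V1| * #|V2|) :=
  mxtens_index (enum_rank p.1, enum_rank p.2).

Lemma pair_of_ordK : cancel pair_of_ord ord_of_pair.
Proof.
move=> k; case: (mxtens_indexP k) => i j.
by rewrite /ord_of_pair /pair_of_ord mxtens_indexK !enum_valK.
Qed.

Lemma ord_of_pairK : cancel ord_of_pair pair_of_ord.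
Proof. by case=> i j; rewrite /pair_of_ord mxtens_indexK !enum_rankK. Qed.

Definition prod_vertex_of_ord (k : 'I_(#|V1| * #|V2| + #|V1| * #|V2|)) :
    prod_vertex V1 V2 :=
  match split k with
  | inl i => inl (pair_of_ord i)
  | inr i => inr (pair_of_ord i)
  end.

Lemma prod_vertex_of_ord_bij : bijective prod_vertex_of_ord.
Proof.
exists (fun x => unsplit match x with
                         | inl p => inl (ord_of_pair p)
                         | inr p => inr (ord_of_pair p)
                         end) => [k|[p|p]].
- rewrite /prod_vertex_of_ord -[RHS]splitK.
  by case: (split k) => i; rewrite pair_of_ordK.
- by rewrite /prod_vertex_of_ord unsplitK ord_of_pairK.
- by rewrite /prod_vertex_of_ord unsplitK ord_of_pairK.
Qed.

End ProductVertices.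

Lemma diag_markv_sq (R : rcfType) (V : finType) (S : signed_graph V) :
  diag_mx (markv R S)^T *m diag_mx (markv R S)^T = 1%:M.
Proof.
rewrite mulmx_diag -diag_const_mx; congr diag_mx; apply/rowP=> i.
rewrite !mxE -intrM.
by case: (mark_sign S (enum_val i)) => ->; rewrite ?mulrNN mulr1.
Qed.

Section ProductAdjacency.
Variables (R : rcfType) (V1 V2 : finType).
Variables (S1 : signed_graph V1) (S2 : signed_graph V2).

Lemma mxsub_adjmx_sgprod
    (e := fun k => enum_rank (@prod_vertex_of_ord V1 V2 k)) :
  mxsub e e (adjmx R (sgprod S1 S2)) =
  sgprod_mx (adjmx R (mu_signed S1)) (diag_mx (markv R S1)^T)
    (adjmx R (mu_signed S2)) (const_mx 1) (markv R S2).
Proof.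
apply/matrixP=> k l; rewrite /sgprod_mx -[in RHS](splitK k) -[in RHS](splitK l).
rewrite 2![LHS]mxE !enum_rankK /prod_vertex_of_ord.
case: (split k) (split l) => i [] j; case: (mxtens_indexP i) => i1 i2;
  case: (mxtens_indexP j) => j1 j2; rewrite /pair_of_ord !mxtens_indexK /=;
  rewrite ?(block_mxEul, block_mxEur, block_mxEdl, block_mxEdr) tensmxE;
  rewrite !mxE ?big_ord1 ?mxE.
- by rewrite !mulr1.
- rewrite (inj_eq enum_val_inj) mul1r intrM.
  by case: eqP => _; rewrite ?mulr1n ?mul0r.
- rewrite (inj_eq enum_val_inj) mulr1 intrM mulrC.
  by case: eqP => [->|_]; rewrite ?mulr1n ?mul0r.
- rewrite (inj_eq enum_val_inj).
  by case: eqP => _; rewrite ?mul1r ?mul0r.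
Qed.

Lemma char_poly_adjmx_sgprod :
  char_poly (adjmx R (sgprod S1 S2)) =
  char_poly (sgprod_mx (adjmx R (mu_signed S1)) (diag_mx (markv R S1)^T)
    (adjmx R (mu_signed S2)) (const_mx 1) (markv R S2)).
Proof.
rewrite -mxsub_adjmx_sgprod char_poly_mxsub_bij //.
exact: bij_comp (enum_rank_bij _) (prod_vertex_of_ord_bij V1 V2).
Qed.

End ProductAdjacency.

Theorem theorem2 (R : rcfType) (V1 V2 : finType)
    (S1 : signed_graph V1) (S2 : signed_graph V2)
    (n2_gt0 : (0 < #|V2|)%N)
    (lam : 'I_#|V1| -> R)
    (lamP : eigenvalues (adjmx R (mu_signed S1)) lam)
    (d : nat) (P F G : {poly R})
    (redP : coronal_reduced_form (mu_signed S2) d P F G) :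
  char_poly (adjmx R (sgprod S1 S2)) =
    'X^(#|V1| * (#|V2| - 1)) * G ^+ #|V1| *
    \prod_(i < #|V1|) ('X * F - #|V2|%:R * ((lam i)%:P * F + P)).
Proof.
case: redP => coronal2 _ _ _ char_poly2.
have := char_poly_sgprod_mx (const_mx 1) (diag_markv_sq R S1) lamP coronal2
  char_poly2.
rewrite dot_ones polyC_natr => char_poly_prod.
have Xn1_neq0 : 'X^#|V1| != 0 :> {poly R} by rewrite expf_neq0 ?polyX_eq0.
apply: (mulfI Xn1_neq0).
rewrite char_poly_adjmx_sgprod char_poly_prod !mulrA -exprD.
by rewrite -mulnS subn1 prednK.
Qed.
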